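(* Let $\mathbb{E}[W^2]<\infty$, fix an integer $q\ge3$ and $0\le B<\log(q-1)$, and assume that $\mathscr{F}_B$ satisfies the zero-crossing condition. For $\beta>0$ let $s_1(\beta,B)$ and $s_3(\beta,B)$ be the smallest and the largest solution $s\in[0,1]$ of the stationarity condition $\mathscr{F}_B(\beta's)=s$, where $\beta'=\mathrm{e}^\beta-1$. Then the optimal value $s^\star(\beta,B)$, i.e. the stationary solution that maximizes $s\mapsto p_{\beta,B}(s)$ over $[0,1]$, is unique except for one value $\beta=\beta_c(B)$. More precisely, there exists a critical inverse temperature $\beta_c(B)\in(0,\infty)$ such that $$s^\star(\beta,B)=\begin{cases}s_1(\beta,B)&\text{for }\beta<\beta_c(B),\\ s_3(\beta,B)&\text{for }\beta>\beta_c(B).\end{cases}$$ Further, $\beta_c(B)$, together with $s_1(\beta_c(B),B)$ and $s_3(\beta_c(B),B)$, is the unique solution of the system formed by the stationarity condition and the criticality condition: $\beta=\beta_c(B)$ is the unique $\beta>0$ for which $s_1(\beta,B)<s_3(\beta,B)$ and $$p_{\beta,B}(s_1(\beta,B))=p_{\beta,B}(s_3(\beta,B)).$$ Finally, $\beta\mapsto s^\star(\beta,B)$ is increasing (in the weak sense), and $0\le s_1(\beta_c(B),B)<s_3(\beta_c(B),B)<\infty$, i.e. the phase transition is first order.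
   Context: $W$ is a non-negative random variable with $\mathbb{E}[W]>0$ such that, for some $c>0$ and $\tau>2$, $\mathbb{P}(W>w)\le c\,w^{-(\tau-1)}$ for all $w\ge1$; it is the limiting weight of a rank-1 inhomogeneous random graph. For $B\ge0$, $t\ge0$, $s\in[0,1]$ define $$\mathscr{F}_B(t)=\mathbb{E}\Big[\frac{W}{\mathbb{E}[W]}\,\frac{\mathrm{e}^{tW+B}-1}{\mathrm{e}^{tW+B}+q-1}\Big],$$ $$p_{\beta,B}(s)=\mathbb{E}\big[\log(\mathrm{e}^{\beta'Ws+B}+q-1)\big]-\frac{\beta'\mathbb{E}[W]}{2q}\big[(q-1)s^2+2s-1\big].$$ Zero-crossing condition for $\mathscr{F}_B$: (a) there is a (unique) $t_*(B)>0$ with $\frac{d^2}{dt^2}\mathscr{F}_B(t)>0$ for $0<t<t_*(B)$ and $\frac{d^2}{dt^2}\mathscr{F}_B(t)<0$ for $t>t_*(B)$; and (b) $\frac{d}{dt}\mathscr{F}_B(t_*(B))>\frac{\mathscr{F}_B(t_*(B))}{t_*(B)}$. *)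

(* Defs.v *)
From HB Require Import structures.
From mathcomp Require Import all_boot all_order all_algebra.
From mathcomp Require Import all_classical all_reals all_analysis.

Set Implicit Arguments.
Unset Strict Implicit.
Unset Printing Implicit Defensive.

Import Order.TTheory GRing.Theory Num.Theory.
Import numFieldNormedType.Exports.

Local Open Scope classical_set_scope.
Local Open Scope ring_scope.

Section Potts.
Context {d : measure_display} {T : measurableType d} {R : realType}.
Variables (P : probability T R) (W : {RV P >-> R}) (q : nat) (B : R).

Definition meanW : R := fine 'E_P[W].

(* Used for t >= 0 only; the same formula makes sense for every real t. *)
Definition scrF (t : R) : R :=
  fine 'E_P[fun x => W x / meanW *
    ((expR (t * W x + B) - 1) / (expR (t * W x + B) + q%:R - 1))].

Definition betap (beta : R) : R := expR beta - 1.

Definition pressure (beta s : R) : R :=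
  fine 'E_P[fun x => ln (expR (betap beta * W x * s + B) + q%:R - 1)]
  - betap beta * meanW / (2 * q%:R) * ((q%:R - 1) * s ^+ 2 + 2 * s - 1).

Definition stationary (beta : R) : set R :=
  [set s | 0 <= s <= 1 /\ scrF (betap beta * s) = s].

(* The possible values of s^star(beta, B). *)
Definition optimal (beta : R) : set R :=
  [set s | stationary beta s /\
           forall r, 0 <= r <= 1 -> pressure beta r <= pressure beta s].

End Potts.

(* The strict sign conditions determine t uniquely.  A derivative whose limit
   does not exist has value 0, so it cannot satisfy them. *)
Definition zero_crossing (R : realType) (f : R -> R) : Prop :=
  exists t : R,
    [/\ 0 < t,
        forall u, 0 < u < t -> 0 < derive1n 2 f u,
        forall u, t < u -> derive1n 2 f u < 0 &
        f t / t < derive1 f t].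

Definition is_smallest (R : realType) (A : set R) (x : R) : Prop :=
  A x /\ lbound A x.

Definition is_largest (R : realType) (A : set R) (x : R) : Prop :=
  A x /\ ubound A x.

(* Main.v *)
Require Import Defs.
From HB Require Import structures.
From mathcomp Require Import all_boot all_order all_algebra.
From mathcomp Require Import all_classical all_reals all_analysis.
From mathcomp Require Import measurable_realfun ring lra.

Import Order.TTheory GRing.Theory Num.Theory.
Import numFieldNormedType.Exports.

Local Open Scope classical_set_scope.
Local Open Scope ring_scope.

(* Put b = e^beta - 1 and t = b s, and let G be a primitive of F = scrF.  Up to
   a positive factor and an additive constant, the pressure at s is
   G t - l t^2 / 2 with l = 1 / b, and the stationary points are the solutions
   of F t = l t, i.e. the points where the slope F t / t equals l.
   The derivative of F t / t has the sign of t F' t - F t, whose own derivative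
   is t F'' t; so the zero-crossing condition makes F t / t decrease on
   (0, tb], increase on [tb, ta] and decrease on [ta, oo).  A maximiser is
   therefore either at most tb, and then it is the smallest crossing, or at
   least ta, and then it is the largest one.  Adding the two optimality
   inequalities shows that maximisers move to the right as l decreases; hence
   as soon as some l has maximisers on both sides, every smaller l has only the
   largest crossing as maximiser and every larger l only the smallest one.
   Such an l is the supremum of those having a maximiser above ta: strict
   inequalities between maxima over compact sets are stable in l. *)

(** * Strict monotonicity from the sign of a derivative *)

Section mean_value_consequences.
Set Implicit Arguments.
Unset Strict Implicit.
Variable R : realType.
Implicit Types (f df : R -> R) (x y t : R).

Lemma is_derive_continuous f x d : is_derive x 1 f d -> {for x, continuous f}.
Proof.
by move=> fd; apply: differentiable_continuous; apply/derivable1_diffP; exact: ex_derive.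
Qed.

Lemma is_derive_within_continuous f df x y :
  (forall u, x <= u <= y -> is_derive u 1 f (df u)) ->
  {within `[x, y], continuous f}.
Proof.
move=> fd; apply: derivable_within_continuous => u; rewrite in_itv/= => uxy.
by have := fd _ uxy => ?; exact: ex_derive.
Qed.

Lemma is_derive_gt0_lt f df x y : x < y ->
  (forall u, x <= u <= y -> is_derive u 1 f (df u)) ->
  (forall u, x < u < y -> 0 < df u) -> f x < f y.
Proof.
move=> xy fd df0.
have [||c] := @MVT _ f df _ _ xy.
- by move=> u; rewrite in_itv/= => /andP[xu uy]; apply: fd; rewrite !ltW.
- exact: is_derive_within_continuous fd.
rewrite in_itv/= => cxy fE.
by rewrite -subr_gt0 fE mulr_gt0 ?subr_gt0// df0.
Qed.

Lemma is_derive_lt0_gt f df x y : x < y ->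
  (forall u, x <= u <= y -> is_derive u 1 f (df u)) ->
  (forall u, x < u < y -> df u < 0) -> f y < f x.
Proof.
move=> xy fd df0.
have [||c] := @MVT _ f df _ _ xy.
- by move=> u; rewrite in_itv/= => /andP[xu uy]; apply: fd; rewrite !ltW.
- exact: is_derive_within_continuous fd.
rewrite in_itv/= => cxy fE.
by rewrite -subr_lt0 fE nmulr_rlt0 ?subr_gt0// df0.
Qed.

Lemma continuous_gt0_near f x : {for x, continuous f} -> 0 < f x ->
  exists2 e, 0 < e & forall u, `|x - u| < e -> 0 < f u.
Proof.
move=> cf f0; have /(_ _ _ f0) := cvgr_gt (f x) cf.
by move=> /nbhs_ballP[e /= e0 fe]; exists e.
Qed.

End mean_value_consequences.

(** * Maximisers of a primitive with quadratic penalty, and their jump as the penalty varies *)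

Section penalised_maxima.
Set Implicit Arguments.
Unset Strict Implicit.
Variables (R : realType) (F G : R -> R) (tb ta : R).
Hypothesis dG : forall t : R, is_derive t 1 G (F t).
Hypothesis cF : continuous F.
Hypothesis F_ge0 : forall t : R, 0 <= t -> 0 <= F t.
Hypothesis F_le1 : forall t, F t <= 1.
Hypothesis tb_ge0 : 0 <= tb.
Hypothesis tb_ta : tb < ta.
Hypothesis tb_eq0 : F 0 = 0 -> tb = 0.
Hypothesis slope_decr_tb :
  forall x y : R, 0 < x -> x < y -> y <= tb -> F y / y < F x / x.
Hypothesis slope_incr :
  forall x y : R, 0 < x -> tb <= x -> x < y -> y <= ta -> F x / x < F y / y.
Hypothesis slope_decr_ta : forall x y : R, ta <= x -> x < y -> F y / y < F x / x.

Definition penalised (l t : R) : R := G t - l * t ^+ 2 / 2.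

Definition crossings (l : R) : set R := [set t | 0 <= t /\ F t = l * t].

Definition maximiser (l t : R) : Prop :=
  0 <= t /\ forall r, 0 <= r -> penalised l r <= penalised l t.

Let ta_gt0 : 0 < ta. Proof. exact: le_lt_trans tb_ge0 tb_ta. Qed.

Lemma crossing_slope l t : 0 < t -> crossings l t -> F t / t = l.
Proof. by move=> t0 [_ ->]; rewrite mulfK// gt_eqF. Qed.

Lemma is_derive_penalised (l t : R) : is_derive t 1 (penalised l) (F t - l * t).
Proof.
have := dG t => ?.
apply: is_derive_eq.
rewrite /= /GRing.scale/=.
by field.
Qed.

Lemma penalised_incr l x y : x < y ->
  (forall u, x < u < y -> l * u < F u) -> penalised l x < penalised l y.
Proof.
move=> xy H; apply: (is_derive_gt0_lt xy (df := fun u => F u - l * u)).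
  by move=> u _; exact: is_derive_penalised.
by move=> u /H; rewrite subr_gt0.
Qed.

Lemma penalised_decr l x y : x < y ->
  (forall u, x < u < y -> F u < l * u) -> penalised l y < penalised l x.
Proof.
move=> xy H; apply: (is_derive_lt0_gt xy (df := fun u => F u - l * u)).
  by move=> u _; exact: is_derive_penalised.
by move=> u /H; rewrite subr_lt0.
Qed.

Lemma continuous_excess l : continuous (fun u => F u - l * u).
Proof.
by move=> t; apply: cvgB; [exact: cF|apply: cvgM; [exact: cvg_cst|exact: cvg_id]].
Qed.

Lemma crossing_le l t : 0 < l -> crossings l t -> t <= l^-1.
Proof.
move=> l0 [t0 FE].
by have := F_le1 t; rewrite FE -ler_pdivlMl// mulr1.
Qed.

(** If [F t > l * t], a small step to the right raises the value. If [F t < l * t], a small step to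
    the left does, and there is room for it: [F 0 >= 0] rules out [t = 0]. So the first-order
    condition is an equality even at the boundary. *)
Lemma maximiser_crossing l t : 0 < l -> maximiser l t -> crossings l t.
Proof.
move=> l0 [t0 tmax]; split=> //; apply/eqP; rewrite eq_le; apply/andP; split.
  rewrite leNgt; apply/negP => lF.
  have := @continuous_excess l t.
  move=> /continuous_gt0_near; rewrite subr_gt0 => /(_ lF)[e e0 he].
  have te : t < t + e / 2 by rewrite ltrDl divr_gt0.
  have : penalised l t < penalised l (t + e / 2).
    apply: penalised_incr => // u /andP[tu ue].
    by rewrite -subr_gt0; apply: he; rewrite ltr_norml; lra.
  by rewrite ltNge tmax//; lra.
rewrite leNgt; apply/negP => lF.
have tp : 0 < t.
  rewrite lt_neqAle t0 andbT; apply/eqP => t00.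
  by move: lF; rewrite -t00 mulr0 ltNge F_ge0.
have := continuousN (@continuous_excess l t).
move=> /continuous_gt0_near; rewrite /= oppr_gt0 subr_lt0 => /(_ lF)[e e0 he].
have [s [s0 st ets]] : exists s, [/\ 0 <= s, s < t & t - e < s].
  exists (Num.max 0 (t - e / 2)); split.
  - by rewrite le_max lexx.
  - by rewrite gt_max tp/=; lra.
  - by rewrite lt_max; apply/orP; right; lra.
have : penalised l t < penalised l s.
  apply: penalised_decr => // u /andP[su ut].
  have := he u; rewrite oppr_gt0 subr_lt0; apply.
  by rewrite ltr_norml; lra.
by rewrite ltNge tmax.
Qed.

(** Beyond [l^-1] the bound [F <= 1] gives [F u < l * u], so the penalised function decreases there
    and a maximum over the compact [[0, l^-1]] is global. *)
Lemma maximiser_exists l : 0 < l -> exists t, maximiser l t.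
Proof.
move=> l0.
have li : 0 < l^-1 by rewrite invr_gt0.
have cP : {within `[0, l^-1], continuous (penalised l)}.
  by apply: is_derive_within_continuous => u _; exact: is_derive_penalised.
have [c] := EVT_max (ltW li) cP.
rewrite in_itv/= => /andP[c0 cl] cmax.
exists c; split=> // r r0.
have [rl|lr] := leP r l^-1; first by apply: cmax; rewrite in_itv/= r0.
apply: le_trans (cmax l^-1 _); last by rewrite in_itv/= lexx ltW.
apply/ltW/penalised_decr => // u /andP[lu _].
by apply: le_lt_trans (F_le1 u) _; rewrite -ltr_pdivrMl// mulr1.
Qed.

Lemma compact_crossings l : 0 < l -> compact (crossings l).
Proof.
move=> l0.
have -> : crossings l = `[0, l^-1] `&` (fun t => F t - l * t) @^-1` [set 0].
  apply/seteqP; split=> [t tZ|t [] /=].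
    split; last by rewrite /=; have [_ ->] := tZ; rewrite subrr.
    by rewrite /= in_itv/= crossing_le// andbT; have [] := tZ.
  by rewrite in_itv/= => /andP[t0 _] /eqP; rewrite subr_eq0 => /eqP.
apply: (@subclosed_compact _ _ `[0, l^-1]); last 2 first.
- exact: segment_compact.
- exact: subIsetl.
apply: closedI; first exact: itv_closed.
apply: closed_comp; last exact: closed_eq.
by move=> x _; exact: continuous_excess.
Qed.

Lemma crossings_nonempty l : 0 < l -> crossings l !=set0.
Proof.
by move=> l0; have [t /(maximiser_crossing l0)] := maximiser_exists l0; exists t.
Qed.

Lemma smallest_crossing l : 0 < l -> exists t, is_smallest (crossings l) t.
Proof.
move=> l0.
have [|c /set_mem cZ cmin] :=
    compact_EVT_min (crossings_nonempty l0) (compact_crossings l0) (f := id).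
  by apply: continuous_subspaceT => x; exact: cvg_id.
by exists c; split=> // r rZ; apply: cmin; rewrite inE.
Qed.

Lemma largest_crossing l : 0 < l -> exists t, is_largest (crossings l) t.
Proof.
move=> l0.
have [|c /set_mem cZ cmax] :=
    compact_EVT_max (crossings_nonempty l0) (compact_crossings l0) (f := id).
  by apply: continuous_subspaceT => x; exact: cvg_id.
by exists c; split=> // r rZ; apply: cmax; rewrite inE.
Qed.

(** Since the slope is strictly monotone on [(0, tb]], the only possible crossing to the left of [t]
    is [0]. That requires [F 0 = 0], hence [tb = 0], which leaves no room below [t]. *)
Lemma crossing_le_tb_smallest l t : crossings l t -> t <= tb ->
  is_smallest (crossings l) t.
Proof.
move=> tZ ttb; split=> // r rZ; rewrite leNgt; apply/negP => rt.
have [r0 rE] := rZ.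
move: r0; rewrite le_eqVlt => /predU1P[r0|r0].
  have /tb_eq0 tb0 : F 0 = 0 by rewrite r0 rE -r0 mulr0.
  by move: rt; rewrite -r0 ltNge -tb0 ttb.
have := slope_decr_tb r0 rt ttb.
by rewrite (crossing_slope _ tZ) ?(crossing_slope _ rZ) ?ltxx// (lt_trans r0).
Qed.

Lemma crossing_ge_ta_largest l t : crossings l t -> ta <= t ->
  is_largest (crossings l) t.
Proof.
move=> tZ tta; split=> // r rZ; rewrite leNgt; apply/negP => tr.
have t0 := lt_le_trans ta_gt0 tta.
have := slope_decr_ta tta tr.
by rewrite (crossing_slope _ tZ) ?(crossing_slope _ rZ) ?ltxx// (lt_trans t0).
Qed.

(* Between [tb] and [ta] the slope [F t / t] increases through [l], so a crossing
   there is a local minimum of [penalised l]. *)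
Lemma maximiser_tb_ta l t : 0 < l -> maximiser l t -> t <= tb \/ ta <= t.
Proof.
move=> l0 tmax; have tZ := maximiser_crossing l0 tmax.
have [|tbt] := leP t tb; first by left.
have [|tta] := leP ta t; first by right.
have t0 : 0 < t by exact: le_lt_trans tb_ge0 tbt.
have : penalised l t < penalised l ta.
  apply: penalised_incr => // u /andP[tu uta].
  rewrite -ltr_pdivlMr ?(lt_trans t0)// -(crossing_slope t0 tZ).
  by apply: slope_incr => //; exact: ltW.
by have [_ /(_ ta (ltW ta_gt0))] := tmax; rewrite leNgt => /negP.
Qed.

Lemma maximiser_comparison l l' t t' : l' < l ->
  maximiser l t -> maximiser l' t' -> t <= t'.
Proof.
move=> ll' [t0 tmax] [t'0 t'max].
have := tmax _ t'0; have := t'max _ t0; rewrite /penalised => h1 h2.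
(* The values of [G] cancel in the sum of the two optimality inequalities. *)
have : 0 <= (l - l') * (t' ^+ 2 - t ^+ 2) by lra.
by rewrite pmulr_rge0 ?subr_gt0// subr_ge0 ler_sqr.
Qed.

(** Compactness turns the strict inequality at [l] into a uniform [gap]. Moving the parameter to
    [l'] changes the difference by [(l' - l) * ((t0 ^+ 2 - t ^+ 2) / 2)], at most [M] times
    [|l' - l|] on [[a, b]]. *)
Lemma penalised_lt_stable l t0 a b : 0 <= a -> a <= b ->
  (forall t, a <= t <= b -> penalised l t < penalised l t0) ->
  exists2 e, 0 < e & forall l' t, `|l' - l| < e -> a <= t <= b ->
    penalised l' t < penalised l' t0.
Proof.
move=> a0 ab lt0.
have cP : {within `[a, b], continuous (penalised l)}.
  by apply: is_derive_within_continuous => u _; exact: is_derive_penalised.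
have [c] := EVT_max ab cP.
rewrite in_itv/= => cab cmax.
have := lt0 _ cab; rewrite -subr_gt0; set gap := _ - _ => gap0.
set M := b ^+ 2 + t0 ^+ 2 + 1.
have M0 : 0 < M by rewrite ltr_wpDl// addr_ge0// sqr_ge0.
exists (gap / M); first exact: divr_gt0.
move=> l' t l'l /andP[at_ tb_].
have h1 : penalised l t <= penalised l t0 - gap.
  by rewrite /gap opprB addrC subrK; apply: cmax; rewrite in_itv/= at_.
have h2 : penalised l' t - penalised l' t0 =
  penalised l t - penalised l t0 + (l' - l) * ((t0 ^+ 2 - t ^+ 2) / 2).
  by rewrite /penalised; field.
have h3 : `|(t0 ^+ 2 - t ^+ 2) / 2| <= M.
  have : t ^+ 2 <= b ^+ 2 by rewrite ler_sqr ?nnegrE; lra.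
  have := sqr_ge0 t0; have := sqr_ge0 t; rewrite /M ler_norml.
  by move: (t ^+ 2) (t0 ^+ 2) (b ^+ 2) => X Y Z; lra.
have h4 : `|(l' - l) * ((t0 ^+ 2 - t ^+ 2) / 2)| < gap.
  rewrite normrM; apply: (le_lt_trans (y := `|l' - l| * M)).
    by rewrite ler_wpM2l.
  by rewrite -ltr_pdivlMr.
by rewrite -subr_lt0 h2; move: h4; rewrite ltr_norml; lra.
Qed.

(** For [l = D / ta ^+ 2] the penalty at [ta] is [D / 2], so the value there is the midpoint of
    [G tb] and [G ta]. This exceeds [G tb], which bounds every value on [[0, tb]] because [G] is
    nondecreasing there. *)
Lemma maximiser_ge_ta_exists :
  exists l, 0 < l /\ exists2 t, maximiser l t & ta <= t.
Proof.
set D := G ta - G tb.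
have D0 : 0 < D.
  rewrite subr_gt0; apply: (is_derive_gt0_lt tb_ta (df := F)) => // u /andP[tbu uta].
  have u0 : 0 < u by exact: le_lt_trans tb_ge0 tbu.
  (* A positive point of [[tb, u)], needed because [tb] may be [0]. Its slope is nonnegative, so the
     slope at [u] is positive. *)
  have v0 : 0 < (Num.max tb (u / 2)) by rewrite lt_max divr_gt0 ?orbT.
  have vu : Num.max tb (u / 2) < u by rewrite gt_max tbu/=; lra.
  have : F (Num.max tb (u / 2)) / Num.max tb (u / 2) < F u / u.
    by apply: slope_incr => //; rewrite ?le_max ?lexx// ltW.
  have : 0 <= F (Num.max tb (u / 2)) / Num.max tb (u / 2).
    by rewrite divr_ge0 ?F_ge0// ltW.
  by move=> h1 /(le_lt_trans h1); rewrite pmulr_lgt0 ?invr_gt0.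
have ta2 : 0 < ta ^+ 2 by rewrite exprn_gt0.
exists (D / ta ^+ 2); split; first exact: divr_gt0.
have l0 : 0 < D / ta ^+ 2 by exact: divr_gt0.
have [t tmax] := maximiser_exists l0.
exists t => //.
have [ttb|//] := maximiser_tb_ta l0 tmax.
have [t0 /(_ _ (ltW ta_gt0))] := tmax.
rewrite /penalised divfK ?gt_eqF// => h.
have h2 : 0 <= D / ta ^+ 2 * t ^+ 2 by rewrite mulr_ge0 ?sqr_ge0// ltW.
have : G t <= G tb.
  move: ttb; rewrite le_eqVlt => /predU1P[->//|ttb].
  apply/ltW; apply: (is_derive_gt0_lt ttb (df := F)) => // u /andP[tu utb].
  have u0 : 0 < u by exact: le_lt_trans t0 tu.
  have tb0 : 0 < tb by exact: lt_trans utb.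
  have := slope_decr_tb u0 utb (lexx _).
  have : 0 <= F tb / tb by rewrite divr_ge0// F_ge0.
  by move=> h1 /(le_lt_trans h1); rewrite pmulr_lgt0 ?invr_gt0.
by move: h h2 D0; move: (_ * t ^+ 2) => X; rewrite /D; lra.
Qed.

(** At the supremum [lc] of [A], a missing maximiser on one side would be missing for all nearby
    parameters too. On the right this contradicts the elements of [A] close to [lc]; on the left it
    puts a parameter above [lc] into [A]. *)
Lemma coexistence_exists : exists lc : R, 0 < lc /\
  exists t1 t3, [/\ maximiser lc t1, t1 <= tb, maximiser lc t3 & ta <= t3].
Proof.
pose A := [set l | 0 < l /\ exists2 t, maximiser l t & ta <= t].
have [lA [lA0 Al]] := maximiser_ge_ta_exists.
have Aub l : A l -> l <= ta^-1.
  move=> [l0 [t tmax tta]].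
  have := crossing_le l0 (maximiser_crossing l0 tmax).
  move=> /(le_trans tta) h.
  by rewrite -[l]invrK lef_pV2// posrE// invr_gt0.
have supA : has_sup A by split; [exists lA; split|exists ta^-1; exact: Aub].
set lc := sup A.
have lc0 : 0 < lc.
  by apply: (lt_le_trans lA0); apply: ub_le_sup; [exact: supA.2|split].
exists lc; split=> //.
have [t0 t0max] := maximiser_exists lc0.
have maxE t : 0 <= t -> penalised lc t0 <= penalised lc t -> maximiser lc t.
  move=> t_ge0 h; split=> // r /(t0max.2 r) h'; exact: le_trans h' h.
have [t3 t3max t3ta] : exists2 t3, maximiser lc t3 & ta <= t3.
  have [t0tb|t0ta] := maximiser_tb_ta lc0 t0max; last by exists t0.
  apply: contrapT => nex.
  (* The cut-off [2 / lc] makes the range compact. It still contains every maximiser beyond [ta] for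
     [l > lc / 2], since crossings are at most [l^-1]. *)
  have [e e0 he] : exists2 e, 0 < e & forall l' t, `|l' - lc| < e ->
      ta <= t <= Num.max ta (2 / lc) -> penalised l' t < penalised l' t0.
    apply: penalised_lt_stable; [exact: ltW|by rewrite le_max lexx|].
    move=> t /andP[tta _]; rewrite ltNge; apply/negP => h; apply: nex.
    by exists t => //; apply: maxE => //; apply: le_trans tta; exact: ltW.
  have eps0 : 0 < Num.min e (lc / 2) by rewrite lt_min e0 divr_gt0.
  have [l Al' ll] := sup_adherent eps0 supA.
  have llc : l <= lc by apply: ub_le_sup; [exact: supA.2|].
  have [lp [t tmax tta]] := Al'.
  have : lc - e < l /\ lc / 2 < l.
    move: ll; rewrite -/lc ltrBlDr -ltrBlDl.
    by rewrite lt_min => /andP[]; lra.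
  move=> [le1 le2].
  have : penalised l t < penalised l t0.
    apply: he; first by rewrite ltr_norml; lra.
    rewrite tta/= le_max; apply/orP; right.
    apply: le_trans (crossing_le lp (maximiser_crossing lp tmax)) _.
    by rewrite -[leRHS]invrK lef_pV2 ?posrE ?invr_gt0// ?divr_gt0// invf_div ltW.
  by rewrite ltNge tmax.2//; exact: t0max.1.
have [t1 t1max t1tb] : exists2 t1, maximiser lc t1 & t1 <= tb.
  have [t0tb|t0ta] := maximiser_tb_ta lc0 t0max; first by exists t0.
  apply: contrapT => nex.
  have [e e0 he] : exists2 e, 0 < e & forall l' t, `|l' - lc| < e ->
      0 <= t <= tb -> penalised l' t < penalised l' t0.
    apply: penalised_lt_stable => // t /andP[t_ge0 ttb].
    rewrite ltNge; apply/negP => h; apply: nex.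
    by exists t => //; exact: maxE.
  (* This parameter is close enough to [lc] to have no maximiser below [tb], yet too large to belong
     to [A]. *)
  have l0 : 0 < lc + e / 2 by rewrite addr_gt0// divr_gt0.
  have [t tmax] := maximiser_exists l0.
  have [ttb|tta] := maximiser_tb_ta l0 tmax.
    have : penalised (lc + e / 2) t < penalised (lc + e / 2) t0.
      by apply: he; [rewrite ltr_norml; lra|rewrite tmax.1].
    by rewrite ltNge tmax.2//; exact: t0max.1.
  have : lc + e / 2 <= lc.
    by apply: ub_le_sup; [exact: supA.2|split=> //; exists t].
  by lra.
by exists t1, t3.
Qed.

(** By comparison with the maximisers [t1] and [t3] at [lc], smaller parameters push maximisers
    beyond [t3 >= ta] and larger ones below [t1 <= tb]. In these two ranges a crossing is
    automatically extreme. *)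
Theorem first_order_transition : exists lc : R, [/\ 0 < lc,
  forall l t : R, 0 < l -> l < lc -> maximiser l t -> is_largest (crossings l) t,
  forall l t : R, lc < l -> maximiser l t -> is_smallest (crossings l) t &
  exists t1 t3, [/\ t1 < t3, maximiser lc t1, maximiser lc t3,
    is_smallest (crossings lc) t1 & is_largest (crossings lc) t3]].
Proof.
have [lc [lc0 [t1 [t3 [t1max t1tb t3max t3ta]]]]] := coexistence_exists.
exists lc; split=> //.
- move=> l t l0 llc tmax; apply: crossing_ge_ta_largest.
    exact: maximiser_crossing.
  exact: le_trans t3ta (maximiser_comparison llc t3max tmax).
- move=> l t llc tmax; apply: crossing_le_tb_smallest.
    by apply: maximiser_crossing => //; exact: lt_trans llc.
  exact: le_trans (maximiser_comparison llc tmax t1max) t1tb.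
exists t1, t3; split=> //.
- exact: le_lt_trans t1tb (lt_le_trans tb_ta t3ta).
- by apply: crossing_le_tb_smallest => //; exact: maximiser_crossing.
- by apply: crossing_ge_ta_largest => //; exact: maximiser_crossing.
Qed.

End penalised_maxima.

(** * From the zero-crossing condition to the shape of the slope [F t / t] *)

Section zero_crossing_slope.
Set Implicit Arguments.
Unset Strict Implicit.
Variables (R : realType) (F : R -> R).
Hypothesis dF : forall t : R, derivable F t 1.
Hypothesis F_ge0 : forall t : R, 0 <= t -> 0 <= F t.
Hypothesis F_le1 : forall t : R, F t <= 1.

(** A divergent difference quotient gives [derive1] its default value [0]. Thus the strict signs of
    the second derivative already yield differentiability of [derive1 F]. *)
Lemma derive1_neq0_derivable (f : R -> R) (t : R) :
  (derive1 f) t != 0 -> derivable f t 1.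
Proof.
rewrite derive1E => ft; apply: contrapT => /dvgP h.
by move: ft; rewrite /derive h eqxx.
Qed.

Lemma is_derive_derive1 (f : R -> R) (t : R) :
  derivable f t 1 -> is_derive t 1 f ((derive1 f) t).
Proof. by move=> ft; rewrite derive1E; exact: DeriveDef. Qed.

(* The sign of [chord_excess t] is that of the derivative of [F t / t]. *)
Let chord_excess (t : R) : R := t * (derive1 F) t - F t.

Lemma is_derive_chord_excess (t : R) : (derive1 (derive1 F)) t != 0 ->
  is_derive t 1 chord_excess (t * (derive1 (derive1 F)) t).
Proof.
move=> F2; have Ft := is_derive_derive1 (@dF t).
have F1t := is_derive_derive1 (derive1_neq0_derivable F2).
apply: is_derive_eq.
by rewrite /GRing.scale/=; ring.
Qed.

Lemma is_derive_slope (t : R) : 0 < t ->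
  is_derive t 1 (fun u => F u / u) (chord_excess t / t ^+ 2).
Proof.
move=> t0; have Ft := is_derive_derive1 (@dF t).
have tn0 : t != 0 by rewrite gt_eqF.
have Vt : is_derive t 1 (fun u : R => u^-1) (- t ^- 2 *: 1) by exact: is_deriveV.
apply: is_derive_eq.
by rewrite /GRing.scale/= /chord_excess; field.
Qed.

Lemma slope_incr_of_chord (x y : R) : 0 < x -> x < y ->
  (forall u, x < u < y -> 0 < chord_excess u) -> F x / x < F y / y.
Proof.
move=> x0 xy H.
apply: (is_derive_gt0_lt xy (df := fun u => chord_excess u / u ^+ 2)
   (f := fun u => F u / u)).
  by move=> u /andP[xu _]; apply: is_derive_slope; exact: lt_le_trans xu.
move=> u uxy; have /andP[xu _] := uxy.
by rewrite divr_gt0 ?H// exprn_gt0// (lt_trans x0).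
Qed.

Lemma slope_decr_of_chord (x y : R) : 0 < x -> x < y ->
  (forall u, x < u < y -> chord_excess u < 0) -> F y / y < F x / x.
Proof.
move=> x0 xy H.
apply: (is_derive_lt0_gt xy (df := fun u => chord_excess u / u ^+ 2)
   (f := fun u => F u / u)).
  by move=> u /andP[xu _]; apply: is_derive_slope; exact: lt_le_trans xu.
move=> u uxy; have /andP[xu _] := uxy.
by rewrite pmulr_llt0 ?H// invr_gt0 exprn_gt0// (lt_trans x0).
Qed.

(** Serves at the inflection point, where the hypotheses give no second derivative and so no
    continuity of [chord_excess]: only the sign of the slope's derivative at that single point is
    available. *)
Lemma is_derive_gt0_left (f : R -> R) (t d : R) : is_derive t 1 f d -> 0 < d ->
  forall a, a < t -> exists2 x, a < x < t & f x < f t.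
Proof.
move=> ft d0 a at_.
have : h^-1 *: (f (h *: 1 + t) - f t) @[h --> 0^'] --> d.
  by have [/cvg_ex[l fl] <-] := ft; rewrite /derive (cvg_lim _ fl).
move=> /cvg_dnbhs_at_left/(cvgr_gt d)/(_ _ d0) hpos.
have [h [h0 ha hp]] : exists h : R, [/\ h < 0, a - t < h &
    0 < h^-1 *: (f (h *: 1 + t) - f t)].
  near (0 : R)^'- => h; exists h; split.
  - by near: h; exact: nbhs_left_lt.
  - by near: h; apply: nbhs_left_gt; rewrite subr_lt0.
  - by near: h.
exists (h + t); first by rewrite -ltrBlDr ha/= gtrDr.
by move: hp; rewrite /GRing.scale/= mulr1 nmulr_rgt0 ?invr_lt0// subr_lt0.
Unshelve. all: by end_near. Qed.

(** [chord_excess] increases before the inflection point [ts], is positive at [ts] and decreases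
    after it. Hence it is nonnegative on an interval around [ts] up to endpoints, and [tb] and [ta]
    are the ends of that interval. *)
Lemma zero_crossing_slope_shape : zero_crossing F -> exists tb ta : R,
  [/\ [/\ 0 <= tb, tb < ta & (F 0 = 0 -> tb = 0)],
    forall x y : R, 0 < x -> x < y -> y <= tb -> F y / y < F x / x,
    forall x y : R, 0 < x -> tb <= x -> x < y -> y <= ta -> F x / x < F y / y &
    forall x y : R, ta <= x -> x < y -> F y / y < F x / x].
Proof.
move=> [ts [ts0 Fcvx Fccv Fts]].
have chord_ts : 0 < chord_excess ts.
  by rewrite /chord_excess subr_gt0 mulrC -ltr_pdivrMr.
have chord_incr x y : 0 < x -> x < y -> y < ts ->
    chord_excess x < chord_excess y.
  move=> x0 xy yts.
  have F2 u : x <= u <= y -> 0 < (derive1 (derive1 F)) u.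
    by move=> /andP[xu uy]; apply: Fcvx; rewrite (lt_le_trans x0)//= (le_lt_trans uy).
  apply: (is_derive_gt0_lt xy (df := fun u => u * (derive1 (derive1 F)) u)) => u uxy.
    by apply: is_derive_chord_excess; rewrite gt_eqF// F2.
  have /andP[xu uy] := uxy.
  by rewrite mulr_gt0 ?F2 ?(lt_trans x0 xu) ?ltW.
have chord_decr x y : ts < x -> x < y -> chord_excess y < chord_excess x.
  move=> tsx xy.
  have F2 u : x <= u <= y -> (derive1 (derive1 F)) u < 0.
    by move=> /andP[xu uy]; apply: Fccv; exact: lt_le_trans xu.
  apply: (is_derive_lt0_gt xy (df := fun u => u * (derive1 (derive1 F)) u)) => u uxy.
    by apply: is_derive_chord_excess; rewrite lt_eqF// F2.
  have /andP[xu uy] := uxy.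
  have u0 : 0 < u by apply: lt_trans ts0 (lt_trans tsx xu).
  by rewrite pmulr_rlt0 ?F2 ?ltW.
(* By convexity the chord from [0] to [t] is less steep than the tangent at [t]. When [F 0 = 0] this
   makes [chord_excess] positive from the start, whence [tb = 0]. *)
have chord0 t : 0 < t -> t < ts -> - F 0 < chord_excess t.
  move=> t0 tts.
  have [||c] := @MVT _ F (derive1 F) _ _ t0.
  - by move=> u _; exact: is_derive_derive1.
  - by apply: is_derive_within_continuous => u _; exact: is_derive_derive1.
  rewrite in_itv/= => /andP[c0 ct] FE.
  have F1 : (derive1 F) c < (derive1 F) t.
    have F2 u : c <= u <= t -> 0 < (derive1 (derive1 F)) u.
      by move=> /andP[cu ut]; apply: Fcvx; rewrite (lt_le_trans c0)//= (le_lt_trans ut).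
    apply: (is_derive_gt0_lt ct (df := fun u => (derive1 (derive1 F)) u)) => u cut.
      by apply/is_derive_derive1/derive1_neq0_derivable; rewrite gt_eqF// F2.
    by have /andP[cu ut] := cut; rewrite F2// !ltW.
  have : (derive1 F) c * t < (derive1 F) t * t by rewrite ltr_pM2r.
  by move: FE; rewrite /chord_excess; lra.
pose A := [set t | 0 < t < ts /\ 0 <= chord_excess t].
(* Otherwise the slope would decrease all the way up to [ts], where its derivative is positive. *)
have [a0 [/andP[a00 a0ts] a0A]] : A !=set0.
  apply: contrapT => A0.
  have d : 0 < chord_excess ts / ts ^+ 2 by rewrite divr_gt0// exprn_gt0.
  have [x /andP[x0 xts]] := is_derive_gt0_left (is_derive_slope ts0) d ts0.
  apply/negP; rewrite -leNgt; apply/ltW/slope_decr_of_chord => // u /andP[xu uts].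
  rewrite ltNge; apply/negP => u_ge0; apply: A0; exists u.
  by split=> //; rewrite (lt_trans x0).
have Alb : lbound A 0 by move=> x [/andP[/ltW]].
have infA : has_inf A by split; [exists a0; split=> //; rewrite a00|exists 0].
pose tb := inf A.
have tb_ge0 : 0 <= tb by apply: lb_le_inf => //; exact: infA.1.
have tb_le t : A t -> tb <= t by move=> At; apply: ge_inf => //; exact: infA.2.
have tb_ts : tb < ts.
  by apply: (le_lt_trans _ a0ts); apply: tb_le; split=> //; rewrite a00.
pose A' := [set t | ts <= t /\ 0 <= chord_excess t].
have A'ts : A' ts by split=> //; exact: ltW.
have slope_ts : 0 < F ts / ts.
  apply: (@le_lt_trans _ _ (F a0 / a0)); first by rewrite divr_ge0 ?F_ge0 ?ltW.
  apply: slope_incr_of_chord => // u /andP[a0u uts].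
  by apply: le_lt_trans a0A _; exact: chord_incr.
(* A point of [A'] beyond [ts + (F ts / ts)^-1] would force the slope to increase from [ts] to
   there, whereas [F <= 1] makes it smaller than [F ts / ts]. *)
have supA' : has_sup A'.
  split; first by exists ts.
  exists (ts + (F ts / ts)^-1) => t [tst t_ge0]; rewrite leNgt; apply/negP => tlt.
  set y := ts + (F ts / ts)^-1 in tlt.
  have tsy : ts < y by rewrite ltrDl invr_gt0.
  have y0 : 0 < y by exact: lt_trans tsy.
  have : F ts / ts < F y / y.
    apply: slope_incr_of_chord => // u /andP[tsu uy].
    by apply: le_lt_trans t_ge0 _; apply: chord_decr => //; exact: lt_trans tlt.
  have : F y / y <= y^-1 by rewrite ler_piMl// invr_ge0 ltW.
  have : y^-1 < F ts / ts.
    by rewrite -[ltRHS]invrK ltf_pV2 ?posrE ?invr_gt0// ltrDr.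
  by lra.
pose ta := sup A'.
have ta_ge t : A' t -> t <= ta by move=> At; apply: ub_le_sup => //; exact: supA'.2.
have ts_ta : ts <= ta by exact: ta_ge.
(* Between [u] and the nearer end lies a point with nonnegative [chord_excess]; strict monotonicity
   towards [ts] makes the value at [u] positive. *)
have chord_gt0 u : tb < u < ta -> 0 < chord_excess u.
  move=> /andP[tbu uta]; have [uts|tsu|->//] := ltgtP u ts.
    have ub : 0 < u - tb by rewrite subr_gt0.
    have [v [/andP[v0 vts] v_ge0]] := inf_adherent ub infA.
    rewrite -/tb addrC subrK => vu.
    by apply: le_lt_trans v_ge0 _; exact: chord_incr.
  have ub : 0 < ta - u by rewrite subr_gt0.
  have [v [tsv v_ge0]] := sup_adherent ub supA'.
  rewrite -/ta opprB addrC subrK => uv.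
  by apply: le_lt_trans v_ge0 _; exact: chord_decr.
exists tb, ta; split.
- split=> //; first exact: lt_le_trans ts_ta.
  move=> F0; apply/eqP; rewrite eq_le tb_ge0 andbT leNgt; apply/negP => tb0.
  have : A (tb / 2).
    have tb2 : 0 < tb / 2 < ts by apply/andP; split; lra.
    split=> //; have /andP[h1 h2] := tb2.
    by have := chord0 _ h1 h2; rewrite F0 oppr0 => /ltW.
  by move=> /tb_le; lra.
- move=> x y x0 xy ytb; apply: slope_decr_of_chord => // u /andP[xu uy].
  rewrite ltNge; apply/negP => u_ge0.
  have : tb <= u.
    apply: tb_le; split=> //; rewrite (lt_trans x0)//=.
    by apply: lt_trans uy _; exact: le_lt_trans tb_ts.
  by rewrite leNgt (lt_le_trans uy).
- move=> x y x0 tbx xy yta; apply: slope_incr_of_chord => // u /andP[xu uy].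
  by apply: chord_gt0; rewrite (le_lt_trans tbx)//= (lt_le_trans uy).
- move=> x y tax xy; apply: slope_decr_of_chord => // [|u /andP[xu uy]].
    exact: lt_le_trans ts0 (le_trans ts_ta tax).
  rewrite ltNge; apply/negP => u_ge0.
  have : u <= ta.
    by apply: ta_ge; split=> //; exact: le_trans ts_ta (le_trans tax (ltW xu)).
  by rewrite leNgt (le_lt_trans tax).
Qed.

End zero_crossing_slope.

(** * Differentiation under the expectation *)

Section derivative_under_expectation.
Set Implicit Arguments.
Unset Strict Implicit.
Context {d : measure_display} {T : measurableType d} {R : realType}.
Variables (P : probability T R) (U W : T -> R).
Hypothesis mW : measurable_fun setT W.

Lemma measurable_comp_affine (k : R -> R) (t B : R) : continuous k ->
  measurable_fun setT (fun x => k (t * W x + B)).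
Proof.
move=> kc; apply: (measurableT_comp (continuous_measurable_fun kc)).
by apply: measurable_funD => //; exact: measurable_funM.
Qed.

Lemma integrable_mul_bounded (k : T -> R) (C : R) :
  P.-integrable setT (EFin \o U) -> measurable_fun setT k ->
  (forall x, `|k x| <= C) -> P.-integrable setT (EFin \o (fun x => U x * k x)).
Proof.
move=> Ui km kC.
have C0 (x : T) : 0 <= C by exact: (le_trans (normr_ge0 _) (kC x)).
have Um : measurable_fun setT U by apply/measurable_EFinP; exact: measurable_int Ui.
apply: (le_integrable measurableT (g := (fun x => C%:E * (EFin \o U) x)%E)).
- by apply/measurable_EFinP; exact: measurable_funM.
- move=> x _ /=; rewrite lee_fin !normrM mulrC ler_wpM2r//.
  by rewrite (ger0_norm (C0 x)).
- exact: integrableZl.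
Qed.

(** The derivative of the integrand is dominated by [C * |U x * W x|] uniformly in the parameter.
    With [U] the relative weight this requires the second moment of [W]; with [U = 1], only the
    first. *)
Lemma is_derive_expectation (k dk : R -> R) (C B t : R) :
  P.-integrable setT (EFin \o (fun x => U x * W x)) ->
  (forall t, P.-integrable setT (EFin \o (fun x => U x * k (t * W x + B)))) ->
  (forall x : R, is_derive x 1 k (dk x)) -> (forall x, `|dk x| <= C) ->
  is_derive t 1 (fun t => \int[P]_x (U x * k (t * W x + B)))
    (\int[P]_x (U x * W x * dk (t * W x + B))).
Proof.
move=> UWi ki kd dkC.
pose f t x := U x * k (t * W x + B).
have C0 : 0 <= C by exact: (le_trans (normr_ge0 _) (dkC 0)).
have fd (t' : R) x : is_derive t' 1 (f ^~ x) (U x * W x * dk (t' * W x + B)).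
  have ld : is_derive t' 1 (fun u : R => u * W x + B) (W x).
    by apply: is_derive_eq; rewrite /GRing.scale/=; ring.
  have kld := @is_derive1_comp _ k (fun u : R => u * W x + B) _ _ _ (kd (t' * W x + B)) ld.
  have -> : f ^~ x = (fun u => U x *: (k \o (fun u : R => u * W x + B)) u) by [].
  by apply: is_derive_eq; rewrite /GRing.scale/=; ring.
have pE (t' : R) x : partial1of2 f t' x = U x * W x * dk (t' * W x + B).
  by rewrite /partial1of2 derive1E; exact: derive_val.
have It : (`](t - 1), (t + 1)[%classic : set R) t by rewrite /= in_itv/=; lra.
pose G x := C * `|U x * W x|.
have hi u : (`](t - 1), (t + 1)[%classic : set R) u -> P.-integrable setT (EFin \o f u).
  by move=> _; exact: ki.
have hd (u : R) x : (`](t - 1), (t + 1)[%classic : set R) u -> setT x ->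
    derivable (f ^~ x) u 1.
  by move=> _ _; have := fd u x => ?; exact: ex_derive.
have G0 x : 0 <= G x by rewrite mulr_ge0.
have Gi : P.-integrable setT (EFin \o G).
  have -> : EFin \o G = (fun x => C%:E * (EFin \o (fun x => `|U x * W x|%R)) x)%E by [].
  by apply: integrableZl => //; exact: (integrable_abse UWi).
have Gb (u : R) x : (`](t - 1), (t + 1)[%classic : set R) u -> setT x ->
    `|partial1of2 f u x| <= G x.
  by move=> _ _; rewrite pE normrM /G mulrC ler_wpM2r.
split.
  exact: (derivable_under_integral measurableT It hi hd G0 Gi Gb).
rewrite -derive1E (differentiation_under_integral measurableT It hi hd G0 Gi Gb).
by apply: eq_Rintegral => x _; exact: pE.
Qed.

End derivative_under_expectation.

(** * Derivatives and bounds of the scalar Potts kernels *)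

Section potts_kernels.
Set Implicit Arguments.
Unset Strict Implicit.
Variables (R : realType) (Q : R).
Hypothesis Q2 : (2 : R) <= Q.

Let den_gt0 (x : R) : 0 < expR x + Q - 1.
Proof. by have := expR_gt0 x; have := Q2; lra. Qed.

Lemma is_derive_den (x : R) : is_derive x 1 (fun x => expR x + Q - 1) (expR x).
Proof. by apply: is_derive_eq; rewrite subr0 addr0. Qed.

Lemma is_derive_ln_den (x : R) : is_derive x 1
  (fun x => ln (expR x + Q - 1)) (expR x / (expR x + Q - 1)).
Proof.
have := @is_derive1_comp _ _ (fun x => expR x + Q - 1) _ _ _
  (is_derive1_ln (den_gt0 x)) (is_derive_den x).
by rewrite mulrC.
Qed.

Lemma is_derive_ratio (x : R) : is_derive x 1
  (fun x => (expR x - 1) / (expR x + Q - 1)) (Q * expR x / (expR x + Q - 1) ^+ 2).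
Proof.
have h := den_gt0 x; have hn : expR x + Q - 1 != 0 by rewrite gt_eqF.
have dd := is_derive_den x.
have Vd : is_derive x 1 (fun x => (expR x + Q - 1)^-1)
    (- (expR x + Q - 1) ^- 2 *: expR x) by exact: is_deriveV.
have Nd : is_derive x 1 (fun x => expR x - 1) (expR x).
  by apply: is_derive_eq; rewrite subr0.
have := is_deriveM Nd Vd => Md.
by apply: is_derive_eq; rewrite /GRing.scale/=; field.
Qed.

Lemma expR_den_le1 (x : R) : `|expR x / (expR x + Q - 1)| <= 1.
Proof.
have := expR_gt0 x => ?.
rewrite ger0_norm; last by rewrite divr_ge0 ?ltW.
by rewrite ler_pdivrMr// mul1r; have := Q2; lra.
Qed.

Lemma ratio_le1 (x : R) : `|(expR x - 1) / (expR x + Q - 1)| <= 1.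
Proof.
have := expR_gt0 x => ?; rewrite normrM normfV (gtr0_norm (den_gt0 x)).
by rewrite ler_pdivrMr// mul1r ler_norml; have := Q2; lra.
Qed.

(** A crude bound: twice the expanded square contains [4 * (Q - 1) * expR x], already at least
    [Q * expR x]. *)
Lemma ratio_deriv_le2 (x : R) : `|Q * expR x / (expR x + Q - 1) ^+ 2| <= 2.
Proof.
have e0 := expR_gt0 x; have d0 := den_gt0 x.
rewrite ger0_norm; last by rewrite divr_ge0 ?sqr_ge0// mulr_ge0 ?ltW//; have := Q2; lra.
rewrite ler_pdivrMr ?exprn_gt0//.
have : 0 <= (Q - 2) * expR x by rewrite mulr_ge0 ?(ltW e0)//; have := Q2; lra.
have : 0 <= (expR x) ^+ 2 by exact: sqr_ge0.
have : 0 <= (Q - 2) ^+ 2 by exact: sqr_ge0.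
by have := Q2; nra.
Qed.

Lemma ratio_ge0 (x : R) : 0 <= x -> 0 <= (expR x - 1) / (expR x + Q - 1).
Proof.
by move=> x0; rewrite divr_ge0 ?(ltW (den_gt0 x))// subr_ge0 -expR0 ler_expR.
Qed.

Lemma ratio_le (x y : R) : x <= y ->
  (expR x - 1) / (expR x + Q - 1) <= (expR y - 1) / (expR y + Q - 1).
Proof.
move=> xy; have dE z : (expR z - 1) / (expR z + Q - 1) = 1 - Q / (expR z + Q - 1).
  by have := den_gt0 z => ?; field; rewrite gt_eqF.
rewrite !dE lerD2l lerN2 ler_wpM2l//; first by have := Q2; lra.
by rewrite lef_pV2 ?posrE// lerD2r lerD2r ler_expR.
Qed.

(** Linear growth makes the logarithm integrable once [W] is. The argument is at most
    [expR |x| * (1 + Q)], and [1 + Q <= expR Q]. *)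
Lemma ln_den_le (x : R) : `|ln (expR x + Q - 1)| <= `|x| + Q.
Proof.
have e0 := expR_gt0 x.
rewrite ger0_norm; last by rewrite ln_ge0//; have := Q2; lra.
rewrite -[leRHS]expRK ler_ln ?posrE ?expR_gt0//.
have h1 : expR x <= expR `|x| by rewrite ler_expR ler_norm.
have h2 : 1 + Q <= expR Q by exact: expR_ge1Dx.
have h3 : 1 <= expR `|x| by rewrite -expR0 ler_expR.
rewrite expRD.
have : expR `|x| * (1 + Q) <= expR `|x| * expR Q by rewrite ler_pM2l ?expR_gt0.
have : 0 <= (expR `|x| - 1) * Q by rewrite mulr_ge0//; have := Q2; lra.
by have := Q2; lra.
Qed.

End potts_kernels.

(** * Regularity of [scrF] and its link with the pressure *)

Section potts_functions.
Set Implicit Arguments.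
Unset Strict Implicit.
Context {d : measure_display} {T : measurableType d} {R : realType}.
Variables (P : probability T R) (W : {RV P >-> R}) (q : nat) (B : R).
Hypothesis W_ge0 : forall x, 0 <= W x.
Hypothesis EW_gt0 : (0 < 'E_P[W])%E.
Hypothesis EW2_fin : ('E_P[fun x => (W x ^+ 2)%R] < +oo)%E.
Hypothesis q_ge3 : (3 <= q)%N.
Hypothesis B_ge0 : 0 <= B.

Let m := meanW W.
Let Q : R := q%:R.

Let Q3 : (3 : R) <= Q. Proof. by rewrite /Q ler_nat. Qed.
Let Q2 : (2 : R) <= Q. Proof. by have := Q3; lra. Qed.
Let mW : measurable_fun setT W. Proof. exact: measurable_funPT. Qed.

Lemma fine_expectation (X : T -> R) : fine 'E_P[X] = \int[P]_x X x.
Proof. by rewrite unlock. Qed.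

Lemma integrable_sqr : P.-integrable setT (EFin \o (fun x => W x ^+ 2)).
Proof.
apply/integrableP; split.
  by apply/measurable_EFinP; exact: measurable_funX.
move: EW2_fin; rewrite unlock; apply: le_lt_trans.
rewrite le_eqVlt; apply/orP; left; apply/eqP; apply: eq_integral => x _ /=.
by rewrite ger0_norm// sqr_ge0.
Qed.

Lemma integrable_weight : P.-integrable setT (EFin \o W).
Proof.
apply: (le_integrable measurableT
  (g := ((EFin \o cst 1%R) \+ (EFin \o (fun x => (W x ^+ 2)%R)))%E)).
- exact/measurable_EFinP.
- move=> x _ /=; rewrite lee_fin !ger0_norm// ?addr_ge0 ?sqr_ge0//.
  by have := sqr_ge0 (W x - 1); rewrite sqrrB1; have := W_ge0 x; lra.
apply: integrableD => //; first exact: finite_measure_integrable_cst.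
exact: integrable_sqr.
Qed.

Lemma meanWE : m = \int[P]_x W x. Proof. exact: fine_expectation. Qed.

Lemma meanW_gt0 : 0 < m.
Proof.
have fin : 'E_P[W]%E \is a fin_num.
  by rewrite unlock; exact: integrable_fin_num integrable_weight.
by move: EW_gt0; rewrite /m /meanW -[X in (_ < X)%E](fineK fin) lte_fin.
Qed.

Let mn0 : m != 0. Proof. by rewrite gt_eqF// meanW_gt0. Qed.
Let Qn0 : Q != 0. Proof. by rewrite gt_eqF//; have := Q3; lra. Qed.
Let Q1n0 : Q - 1 != 0. Proof. by rewrite gt_eqF//; have := Q3; lra. Qed.

Lemma integrable_rel_weight : P.-integrable setT (EFin \o (fun x => W x / m)).
Proof.
have -> : EFin \o (fun x => W x / m) = (fun x => (m^-1)%:E * (EFin \o W) x)%E.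
  by apply/funext => x; rewrite /= mulrC EFinM.
by apply: integrableZl => //; exact: integrable_weight.
Qed.

Lemma Rintegral_rel_weight : \int[P]_x (W x / m) = 1.
Proof.
by rewrite RintegralZr//; [rewrite -meanWE divff|exact: integrable_weight].
Qed.

Let ratio (x : R) := (expR x - 1) / (expR x + Q - 1).

Lemma scrFE t : scrF W q B t = \int[P]_x (W x / m * ratio (t * W x + B)).
Proof. exact: fine_expectation. Qed.

Let ratio_cont : continuous ratio.
Proof. by move=> x; apply: is_derive_continuous; exact: is_derive_ratio. Qed.

Lemma integrable_scrF t :
  P.-integrable setT (EFin \o (fun x => W x / m * ratio (t * W x + B))).
Proof.
apply: (integrable_mul_bounded (C := 1)); first exact: integrable_rel_weight.
  exact: measurable_comp_affine.
by move=> x; exact: ratio_le1.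
Qed.

Lemma derivable_scrF (t : R) : derivable (scrF W q B) t 1.
Proof.
rewrite (_ : scrF W q B = fun t => \int[P]_x (W x / m * ratio (t * W x + B))); last first.
  by apply/funext => u; exact: scrFE.
have h : P.-integrable setT (EFin \o (fun x => W x / m * W x)).
  have -> : EFin \o (fun x => W x / m * W x) =
      (fun x => (m^-1)%:E * (EFin \o (fun x => (W x ^+ 2)%R)) x)%E.
    by apply/funext => x; rewrite /= -EFinM; congr EFin; ring.
  by apply: integrableZl => //; exact: integrable_sqr.
have := is_derive_expectation t h integrable_scrF
  (is_derive_ratio Q2) (ratio_deriv_le2 Q2).
by move=> ?; exact: ex_derive.
Qed.

Lemma scrF_ge0 t : 0 <= t -> 0 <= scrF W q B t.
Proof.
move=> t0; rewrite scrFE; apply: Rintegral_ge0 => x _.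
apply: mulr_ge0; first by rewrite divr_ge0 ?(ltW meanW_gt0).
by apply: ratio_ge0 => //; rewrite addr_ge0// mulr_ge0.
Qed.

Lemma scrF_le1 t : scrF W q B t <= 1.
Proof.
rewrite scrFE -Rintegral_rel_weight; apply: le_Rintegral => //.
- exact: integrable_scrF.
- exact: integrable_rel_weight.
move=> x _; rewrite ler_piMr ?divr_ge0 ?(ltW meanW_gt0)//.
by apply: le_trans (ler_norm _) _; exact: ratio_le1.
Qed.

Lemma scrF_le t u : t <= u -> scrF W q B t <= scrF W q B u.
Proof.
move=> tu; rewrite !scrFE; apply: le_Rintegral => //; try exact: integrable_scrF.
move=> x _; rewrite ler_wpM2l ?divr_ge0 ?(ltW meanW_gt0)//.
by apply: ratio_le => //; rewrite lerD2r ler_wpM2r.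
Qed.

Definition log_partition (t : R) : R :=
  \int[P]_x ln (expR (t * W x + B) + Q - 1).

(* A primitive of [scrF], since
   [e^x / (e^x + q - 1) = 1/q + (q - 1)/q * (e^x - 1) / (e^x + q - 1)]. *)
Definition scrF_primitive (t : R) : R :=
  Q / ((Q - 1) * m) * log_partition t - t / (Q - 1).

Lemma is_derive_log_partition (t : R) : is_derive t 1 log_partition
  (m / Q + (Q - 1) * m / Q * scrF W q B t).
Proof.
have k_cont : continuous (fun x : R => ln (expR x + Q - 1)).
  by move=> x; apply: is_derive_continuous; exact: is_derive_ln_den.
have i1 : P.-integrable setT (EFin \o (fun x => cst 1 x * W x)).
  by rewrite (_ : (fun x => _) = W)//; [exact: integrable_weight|
    apply/funext => x; rewrite /= mul1r].
have ik u : P.-integrable setT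
    (EFin \o (fun x => cst 1 x * ln (expR (u * W x + B) + Q - 1))).
  apply: (le_integrable measurableT
    (g := ((fun x => `|u|%R%:E * (EFin \o W) x) \+ (EFin \o cst (`|B| + Q)%R))%E)).
  - apply/measurable_EFinP/measurable_funM => //.
    exact: measurable_comp_affine k_cont.
  - move=> x _ /=; rewrite lee_fin mul1r.
    apply: le_trans (ln_den_le Q2 _) _.
    rewrite (ger0_norm (_ : 0 <= `|u| * W x + (`|B| + Q))).
      rewrite addrA lerD2r; apply: le_trans (ler_normD _ _) _.
      by rewrite normrM (ger0_norm (W_ge0 x)).
    by rewrite !addr_ge0 ?mulr_ge0//; have := Q2; lra.
  apply: integrableD => //; last exact: finite_measure_integrable_cst.
  by apply: integrableZl => //; exact: integrable_weight.
have := is_derive_expectation t i1 ik (is_derive_ln_den Q2) (expR_den_le1 Q2).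
set D := Rintegral _ _ _ => h.
have -> : log_partition = (fun t => \int[P]_x (cst 1 x * ln (expR (t * W x + B) + Q - 1))).
  by apply/funext => u; apply: eq_Rintegral => x _; rewrite /= mul1r.
apply: is_derive_eq h _.
rewrite scrFE -RintegralZl//; last exact: integrable_scrF.
have -> : m / Q = \int[P]_x (W x / Q).
  by rewrite RintegralZr//; [rewrite -meanWE|exact: integrable_weight].
have iQ : P.-integrable setT (EFin \o (fun x => W x / Q)).
  have -> : EFin \o (fun x => W x / Q) = (fun x => (Q^-1)%:E * (EFin \o W) x)%E.
    by apply/funext => x; rewrite /= mulrC EFinM.
  by apply: integrableZl => //; exact: integrable_weight.
rewrite -RintegralD//; last first.
  rewrite (_ : EFin \o _ = (fun x => ((Q - 1) * m / Q)%:E *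
      (EFin \o (fun x => (W x / m * ratio (t * W x + B))%R)) x)%E)//.
  by apply: integrableZl => //; exact: integrable_scrF.
apply: eq_Rintegral => x _ /=; rewrite /ratio.
have dn0 : expR (t * W x + B) + Q - 1 != 0.
  by rewrite gt_eqF//; have := expR_gt0 (t * W x + B); have := Q2; lra.
by field; rewrite Qn0 mn0 dn0.
Qed.

Lemma is_derive_scrF_primitive (t : R) :
  is_derive t 1 scrF_primitive (scrF W q B t).
Proof.
have := is_derive_log_partition t => h.
rewrite /scrF_primitive; apply: is_derive_eq.
by rewrite /GRing.scale/=; field; rewrite Qn0 mn0 Q1n0.
Qed.

(** In the variable [t = betap beta * s], the term in [s ^+ 2] becomes the quadratic penalty with
    [l = (betap beta)^-1], the linear term is the [- t / (Q - 1)] of [scrF_primitive], and only the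
    constant is left over. *)
Lemma pressureE beta s : 0 < betap beta ->
  pressure W q B beta s = betap beta * m / (2 * Q)
    + (Q - 1) * m / Q * penalised scrF_primitive (betap beta)^-1 (betap beta * s).
Proof.
move=> b0; have bn0 : betap beta != 0 by rewrite gt_eqF.
rewrite /pressure fine_expectation -/m -/Q.
have -> : \int[P]_x ln (expR (betap beta * W x * s + B) + Q - 1)
    = log_partition (betap beta * s).
  by apply: eq_Rintegral => x _; rewrite mulrAC.
rewrite /penalised /scrF_primitive.
by field; rewrite Qn0 mn0 Q1n0 bn0.
Qed.

End potts_functions.

(** * Translation from [l] and [t] back to [beta] and [s] *)

Theorem theorem1p11 (d : measure_display) (T : measurableType d)
    (R : realType) (P : probability T R) (W : {RV P >-> R})
    (hW_ge0 : forall x, 0 <= W x)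
    (hEW : (0 < 'E_P[W])%E)
    (c tau : R) (hc : 0 < c) (htau : 2 < tau)
    (htail : forall w : R, 1 <= w ->
       (P [set x | (w < W x)%R] <= (c * w `^ (- (tau - 1)))%:E)%E)
    (hEW2 : ('E_P[fun x => (W x ^+ 2)%R] < +oo)%E)
    (q : nat) (hq : (3 <= q)%N)
    (B : R) (hB : 0 <= B < ln (q%:R - 1))
    (hF : zero_crossing (scrF W q B)) :
  exists s1 s3 : R -> R,
    (forall beta, 0 < beta ->
       is_smallest (stationary W q B beta) (s1 beta) /\
       is_largest (stationary W q B beta) (s3 beta)) /\
    exists betac : R,
      [/\ 0 < betac,
          (forall beta, 0 < beta ->
             ((exists! s, optimal W q B beta s) <-> beta != betac)),
          (forall beta, 0 < beta < betac ->
             optimal W q B beta = [set s1 beta]) /\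
          (forall beta, betac < beta ->
             optimal W q B beta = [set s3 beta]),
          (forall beta, 0 < beta ->
             (s1 beta < s3 beta /\
              pressure W q B beta (s1 beta) = pressure W q B beta (s3 beta)
              <-> beta = betac)) &
          (forall beta beta' s s', 0 < beta -> beta < beta' ->
             optimal W q B beta s -> optimal W q B beta' s' -> s <= s') /\
          0 <= s1 betac < s3 betac].
Proof.
move: hB => /andP[B0 _].
pose F := scrF W q B; pose G := scrF_primitive W q B.
have dF (t : R) : derivable F t 1 by exact: (@derivable_scrF _ _ _ _ _ _ B hW_ge0 hEW2 hq t).
have F_ge0 (t : R) : 0 <= t -> 0 <= F t by exact: scrF_ge0.
have F_le1 (t : R) : F t <= 1 by exact: scrF_le1.
have cF : continuous F.
  by move=> t; apply: is_derive_continuous; apply: is_derive_derive1; exact: dF.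
have dG (t : R) : is_derive t 1 G (F t) by exact: is_derive_scrF_primitive.
have [tb [ta [[tb0 tbta F0] dec1 inc dec2]]] :=
  zero_crossing_slope_shape dF F_ge0 F_le1 hF.
have [lc [lc0 largest_below smallest_above [t1 [t3 [t13 t1max t3max t1s t3l]]]]] :=
  first_order_transition dG cF F_ge0 F_le1 tb0 tbta F0 dec1 inc dec2.
have b_gt0 beta : 0 < beta -> 0 < betap beta :> R.
  by move=> beta0; rewrite /betap subr_gt0 expR_gt1.
have betap_lt beta beta' : beta < beta' -> betap beta < betap beta' :> R.
  by move=> h; rewrite /betap ltrD2r ltr_expR.
have l_gt0 beta : 0 < beta -> 0 < (betap beta)^-1 :> R.
  by move=> beta0; rewrite invr_gt0 b_gt0.
have l_lt beta beta' : 0 < beta -> beta < beta' ->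
    (betap beta')^-1 < (betap beta)^-1 :> R.
  move=> h1 h2; rewrite ltf_pV2 ?posrE ?b_gt0// ?betap_lt//.
  exact: lt_trans h2.
(* The constraint [0 <= s <= 1] is automatic on the right-hand side, since [s] is then a value of
   [F] at a nonnegative point. *)
have statE beta s : 0 < beta ->
    stationary W q B beta s <-> crossings F (betap beta)^-1 (betap beta * s).
  move=> /b_gt0 b0; rewrite /stationary /crossings /= mulKf ?gt_eqF//.
  split=> [[/andP[s0 s1] sE]|[bs0 sE]]; split=> //.
    by rewrite mulr_ge0// ltW.
  by rewrite -sE F_le1 F_ge0.
have pressure_le beta r s : 0 < beta ->
    (pressure W q B beta r <= pressure W q B beta s) =
    (penalised G (betap beta)^-1 (betap beta * r) <=
     penalised G (betap beta)^-1 (betap beta * s)).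
  move=> /b_gt0 b0; rewrite !(pressureE _ hW_ge0 hEW hEW2 hq)// lerD2l ler_pM2l//.
  have q1 : (1 : R) < q%:R by rewrite ltr1n (leq_trans _ hq).
  rewrite divr_gt0 ?mulr_gt0 ?subr_gt0 ?(meanW_gt0 hW_ge0)//.
  exact: lt_trans q1.
(* Maximising over [[0, 1]] or over all [t >= 0] is the same: a global maximiser is a crossing, so
   its [s] lies in [[0, 1]]. *)
have optE beta s : 0 < beta ->
    optimal W q B beta s <-> maximiser G (betap beta)^-1 (betap beta * s).
  move=> beta0; have b0 := b_gt0 _ beta0; have l0 := l_gt0 _ beta0.
  have bK r : betap beta * (r / betap beta) = r by rewrite mulrC divfK// gt_eqF.
  split=> [[/(statE _ _ beta0) sZ sopt]|smax].
    have [t tmax] := maximiser_exists dG F_le1 l0.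
    have tZ := maximiser_crossing dG cF F_ge0 l0 tmax.
    split; first exact: sZ.1.
    move=> r r0; apply: le_trans (tmax.2 r r0) _.
    rewrite -[t]bK -pressure_le//; apply: sopt.
    by have /(statE _ _ beta0)[] : crossings F (betap beta)^-1
      (betap beta * (t / betap beta)) by rewrite bK.
  split; first by apply/statE => //; exact: maximiser_crossing smax.
  move=> r /andP[r0 _]; rewrite pressure_le//; apply: smax.2.
  by rewrite mulr_ge0// ltW.
have /choice[s1 hs1] : forall beta : R, exists s : R, 0 < beta ->
    is_smallest (crossings F (betap beta)^-1) (betap beta * s).
  move=> beta.
  have [beta0|] := ltP 0 beta; last by exists 0.
  have [t ts] := smallest_crossing dG cF F_ge0 F_le1 (l_gt0 _ beta0).
  by exists (t / betap beta) => _; rewrite mulrC divfK// gt_eqF// b_gt0.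
have /choice[s3 hs3] : forall beta : R, exists s : R, 0 < beta ->
    is_largest (crossings F (betap beta)^-1) (betap beta * s).
  move=> beta.
  have [beta0|] := ltP 0 beta; last by exists 0.
  have [t ts] := largest_crossing dG cF F_ge0 F_le1 (l_gt0 _ beta0).
  by exists (t / betap beta) => _; rewrite mulrC divfK// gt_eqF// b_gt0.
have smallest_unique (A : set R) x y : is_smallest A x -> is_smallest A y -> x = y.
  by move=> [Ax xA] [Ay yA]; apply/le_anti; rewrite xA//= yA.
have largest_unique (A : set R) x y : is_largest A x -> is_largest A y -> x = y.
  by move=> [Ax xA] [Ay yA]; apply/le_anti; rewrite xA//= yA.
have stat1 beta : 0 < beta -> is_smallest (stationary W q B beta) (s1 beta).
  move=> beta0; have [Z1 lb1] := hs1 _ beta0; split; first exact/statE.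
  by move=> s /(statE _ _ beta0)/lb1; rewrite ler_pM2l// b_gt0.
have stat3 beta : 0 < beta -> is_largest (stationary W q B beta) (s3 beta).
  move=> beta0; have [Z3 ub3] := hs3 _ beta0; split; first exact/statE.
  by move=> s /(statE _ _ beta0)/ub3; rewrite ler_pM2l// b_gt0.
exists s1, s3; split; first by move=> beta beta0; split; [exact: stat1|exact: stat3].
(* The solution of [(betap beta)^-1 = lc]. *)
pose betac := ln (1 + lc^-1).
have lci0 : 0 < lc^-1 by rewrite invr_gt0.
have betac0 : 0 < betac by rewrite ln_gt0// ltrDl.
have betacE : (betap betac)^-1 = lc.
  by rewrite /betap lnK ?posrE ?addr_gt0// addrC addKr invrK.
have lt_opt beta : 0 < beta -> beta < betac ->
    optimal W q B beta = [set s1 beta].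
  move=> beta0 lt_c; have b0 := b_gt0 _ beta0; have l0 := l_gt0 _ beta0.
  have llc : lc < (betap beta)^-1 by rewrite -betacE l_lt.
  have only s : optimal W q B beta s -> s = s1 beta.
    move=> /(optE _ _ beta0)/(smallest_above _ _ llc) h.
    have bn0 : betap beta != 0 by rewrite gt_eqF.
    apply: (mulfI bn0).
    exact: smallest_unique h (hs1 _ beta0).
  apply/seteqP; split=> s //=; first exact: only.
  move=> ->; have [t tmax] := maximiser_exists dG F_le1 l0.
  have topt : optimal W q B beta (t / betap beta).
    by apply/optE => //; rewrite mulrC divfK// gt_eqF.
  by rewrite -(only _ topt).
have gt_opt beta : betac < beta -> optimal W q B beta = [set s3 beta].
  move=> c_lt; have beta0 := lt_trans betac0 c_lt.
  have b0 := b_gt0 _ beta0; have l0 := l_gt0 _ beta0.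
  have llc : (betap beta)^-1 < lc by rewrite -betacE l_lt.
  have only s : optimal W q B beta s -> s = s3 beta.
    move=> /(optE _ _ beta0)/(largest_below _ _ l0 llc) h.
    have bn0 : betap beta != 0 by rewrite gt_eqF.
    apply: (mulfI bn0).
    exact: largest_unique h (hs3 _ beta0).
  apply/seteqP; split=> s //=; first exact: only.
  move=> ->; have [t tmax] := maximiser_exists dG F_le1 l0.
  have topt : optimal W q B beta (t / betap beta).
    by apply/optE => //; rewrite mulrC divfK// gt_eqF.
  by rewrite -(only _ topt).
have bc0 := b_gt0 _ betac0.
have s1c : betap betac * s1 betac = t1.
  by have := hs1 _ betac0; rewrite betacE => h; exact: smallest_unique h t1s.
have s3c : betap betac * s3 betac = t3.
  by have := hs3 _ betac0; rewrite betacE => h; exact: largest_unique h t3l.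
have opt1c : optimal W q B betac (s1 betac).
  by apply/optE => //; rewrite s1c betacE.
have opt3c : optimal W q B betac (s3 betac).
  by apply/optE => //; rewrite s3c betacE.
have s13c : s1 betac < s3 betac by rewrite -(ltr_pM2l bc0) s1c s3c.
have opt_range beta s : optimal W q B beta s -> 0 <= s <= 1 by move=> [[]].
exists betac; split=> //.
- move=> beta beta0; split.
    move=> [s [_ s_uniq]]; apply/eqP => betaE; subst beta.
    by move: s13c; rewrite -(s_uniq _ opt1c) -(s_uniq _ opt3c) ltxx.
  move=> /lt_total/orP[lt_c|gt_c].
    by exists (s1 beta); rewrite lt_opt//; split=> // s ->.
  by exists (s3 beta); rewrite gt_opt//; split=> // s ->.
- by split=> // beta /andP[]; exact: lt_opt.
- move=> beta beta0; split=> [[s13 pE]|->]; last first.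
    split=> //; apply/le_anti.
    by rewrite opt3c.2 ?opt1c.2// ?(opt_range _ _ opt1c) ?(opt_range _ _ opt3c).
  (* Away from [betac] one of [s1 beta], [s3 beta] is the only optimum; equal pressures would make
     the other optimal as well, so they would coincide. *)
  have [lt_c|gt_c|//] := ltgtP beta betac.
    have o1 : optimal W q B beta (s1 beta) by rewrite lt_opt.
    have : optimal W q B beta (s3 beta).
      split; first exact: (stat3 _ beta0).1.
      by rewrite -pE; exact: o1.2.
    by rewrite lt_opt//= => s31; move: s13; rewrite s31 ltxx.
  have o3 : optimal W q B beta (s3 beta) by rewrite gt_opt.
  have : optimal W q B beta (s1 beta).
    split; first exact: (stat1 _ beta0).1.
    by rewrite pE; exact: o3.2.
  by rewrite gt_opt//= => s31; move: s13; rewrite s31 ltxx.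
- split; last by rewrite s13c andbT; have /andP[] := opt_range _ _ opt1c.
  move=> beta beta' s s' beta0 bb' sopt s'opt.
  have beta'0 := lt_trans beta0 bb'.
  (* The comparison orders only the products [betap beta * s]. Writing [s] and [s'] as values of the
     nondecreasing [scrF] at these products transfers the order to them. *)
  have [_ <-] := sopt.1; have [_ <-] := s'opt.1; apply: scrF_le => //.
  apply: (maximiser_comparison (l_lt _ _ beta0 bb')); exact/optE.
Qed.
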